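(* Let $X$ be a real Banach space, $(Y,d)$ a complete metric space, and $F\colon X\rightrightarrows Y$ a set-valued mapping with closed values. For $y\in Y$ put $\psi_y(x)=d(y,F(x))$, $x\in X$. Suppose that for every $y\in Y$ the function $\psi_y(\cdot)$ is lower semicontinuous, and let $(\overline{x},\overline{y})\in\mathrm{Graph}\,F$ and $K>0$ be given. (1) Suppose that there exists $r>0$ such that for any $(x,y)\in B(\overline{x},r)\times B(\overline{y},r)$ with $y\notin F(x)$ the function $\psi_y(\cdot)$ is (Dini) quasidifferentiable at $x$, with a given quasidifferential $[\underline{\partial}\psi_y(x),\overline{\partial}\psi_y(x)]$, and there exists $w^*\in\overline{\partial}\psi_y(x)$ for which $$d\big(\mathbb{O},\underline{\partial}\psi_y(x)+w^*\big)>\frac1K .$$ Then for any $(x,y)\in B(\overline{x},r)\times B(\overline{y},r)$ such that $K\,d(y,F(x))<r-\|x-\overline{x}\|$ one has $d(x,F^{-1}(y))\le K\,d(y,F(x))$; in particular, $F$ is metrically regular near $(\overline{x},\overline{y})$ with the norm of metric regularity not exceeding $K$. (2) Suppose (instead of the assumption in (1)) that $Y$ is a Banach space, $X$ is finite dimensional, and there is $r>0$ such that for any $y\in Y$ the function $\psi_y(\cdot)$ is Hadamard quasidifferentiable at every point $x$ of $B(\overline{x},r)$, with a given Hadamard quasidifferential $[\underline{\partial}\psi_y(x),\overline{\partial}\psi_y(x)]$. Then $F$ is metrically regular near $(\overline{x},\overline{y})$ with the norm of metric regularity not exceeding $K$ if and only if for any $t>K$ there exists a neighbourhood $U\subseteq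 B(\overline{x},r)\times Y$ of $(\overline{x},\overline{y})$ such that for any $(x,y)\in U\setminus\mathrm{Graph}\,F$ there exists $w^*\in\overline{\partial}\psi_y(x)$ for which $d(\mathbb{O},\underline{\partial}\psi_y(x)+w^* )\ge t^{-1}$.
   Context: Notation: $X^*$ is the topological dual of $X$ with the dual norm, $\mathbb{O}$ is the zero vector, $\mathrm{Graph}\,F=\{(x,y)\in X\times Y: y\in F(x)\}$, $F^{-1}(y)=\{x\in X: y\in F(x)\}$. In any metric (or normed) space, $B(a,r)$ is the closed ball with centre $a$ and radius $r$, and $d(a,C)=\inf_{c\in C}d(a,c)$, with $d(a,\emptyset)=+\infty$; in $X$, $X^*$ and (when it is a Banach space) $Y$ distances are given by the norm. Thus $d(\mathbb{O},\underline{\partial}\psi_y(x)+w^* )=\inf\{\|v^*+w^*\|: v^*\in\underline{\partial}\psi_y(x)\}$. Quasidifferentiability. Let $U\subset X$ be open and $f\colon U\to\mathbb{R}$. $f$ is Dini (respectively Hadamard) directionally differentiable at $x\in U$ if for every $h\in X$ the finite limit $f'(x,h)=\lim_{\alpha\to+0}\frac{f(x+\alpha h)-f(x)}{\alpha}$ (respectively $f'(x,h)=\lim_{[\alpha,h']\to[+0,h]}\frac{f(x+\alpha h')-f(x)}{\alpha}$) exists. $f$ is Dini (Hadamard) quasidifferentiable at $x$ if it is Dini (Hadamard) directionally differentiable at $x$ and there is a pair $[\underline{\partial}f(x),\overline{\partial}f(x)]$ of (nonempty) convex weak$^*$ compact subsets of $X^*$ such that $$f'(x,h)=\max_{v^*\in\underline{\partial}f(x)}\langle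 v^*,h\rangle+\min_{w^*\in\overline{\partial}f(x)}\langle w^*,h\rangle\quad\forall h\in X.$$ Any such pair is called a Dini (Hadamard) quasidifferential of $f$ at $x$; it is not unique, and whenever a function is said to be quasidifferentiable at a point, some quasidifferential at that point is assumed to be given. ''Quasidifferentiable'' without qualification means Dini quasidifferentiable. (Saying that $\psi_y$ is quasidifferentiable at $x$ includes that $\psi_y$ is finite in a neighbourhood of $x$.) Metric regularity. $F$ is metrically regular near $(\overline{x},\overline{y})\in\mathrm{Graph}\,F$ if there exist $K>0$ and $r>0$ such that $d(x,F^{-1}(y))\le K\,d(y,F(x))$ for all $(x,y)\in B(\overline{x},r)\times B(\overline{y},r)$. The infimum of all $K$ for which this inequality holds with some $r>0$ is called the norm of metric regularity of $F$ near $(\overline{x},\overline{y})$. *)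

(* Defs.v *)
From HB Require Import structures.
From mathcomp Require Import all_boot all_order all_algebra.
From mathcomp Require Import all_classical all_reals all_analysis.

Set Implicit Arguments.
Unset Strict Implicit.
Unset Printing Implicit Defensive.

Import Order.TTheory GRing.Theory Num.Theory.
Import numFieldNormedType.Exports.

Local Open Scope classical_set_scope.
Local Open Scope ring_scope.

#[short(type="completeMetricType")]
HB.structure Definition CompleteMetric (R : numDomainType) :=
  {M of Metric R M & Complete M}.

(* Distances are passed explicitly, because [normedModType] does not inherit
   from [metricType]: [mdist] is used on metric spaces, [normdist] on normed
   spaces. *)
Definition normdist (R : realType) (V : normedModType R) (a b : V) : R :=
  `|a - b|.

Section Distances.
Context {R : realType} {T : Type}.
Variable d : T -> T -> R.

(* Equal to +oo when [C] is empty. *)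
Definition dist_set (a : T) (C : set T) : \bar R :=
  ereal_inf [set (d a c)%:E | c in C].

Definition cball (a : T) (r : R) : set T := [set b | d a b <= r].

End Distances.

Section MetricRegularity.
Context {R : realType} {X : normedModType R} {Y : Type}.
Variables (d : Y -> Y -> R) (F : X -> set Y).

Definition graph : set (X * Y) := [set p | F p.1 p.2].

Definition inverse (y : Y) : set X := [set x | F x y].

Definition psi (y : Y) (x : X) : \bar R := dist_set d y (F x).

Definition regular_with (xb : X) (yb : Y) (K r : R) : Prop :=
  forall x y, cball (@normdist R X) xb r x -> cball d yb r y ->
    (dist_set (@normdist R X) x (inverse y) <= K%:E * dist_set d y (F x))%E.

Definition metrically_regular (xb : X) (yb : Y) : Prop :=
  exists K r : R, [/\ 0 < K, 0 < r & regular_with xb yb K r].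

Definition regularity_norm (xb : X) (yb : Y) : \bar R :=
  ereal_inf [set K%:E | K in
    [set K : R | 0 < K /\ exists2 r : R, 0 < r & regular_with xb yb K r]].

End MetricRegularity.

Section DirectionalDerivatives.
Context {R : realType} {X : normedModType R}.
Variables (f : X -> R) (x : X).

Definition dini_quotient (h : X) (a : R) : R := (f (x + a *: h) - f x) / a.

Definition dini_differentiable : Prop :=
  forall h, cvg (dini_quotient h @ 0^'+).

Definition dini_derivative (h : X) : R := lim (dini_quotient h @ 0^'+).

Definition hadamard_quotient (p : R * X) : R :=
  (f (x + p.1 *: p.2) - f x) / p.1.

Definition hadamard_differentiable : Prop :=
  forall h : X, cvg (hadamard_quotient @ filter_prod 0^'+ (nbhs h)).

Definition hadamard_derivative (h : X) : R :=
  lim (hadamard_quotient @ filter_prod 0^'+ (nbhs h)).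

End DirectionalDerivatives.

Section Dual.
Context {R : realType} {X : normedModType R}.

(* The topological dual, as a subspace of the space of all functions. *)
Definition dual : set (X -> R^o) := [set v | linear v /\ continuous v].

Definition dual_norm (v : X -> R^o) : \bar R :=
  ereal_sup [set (`|v h|)%:E | h in [set h : X | `|h| <= 1]].

Definition dual_dist0 (A : set (X -> R^o)) : \bar R :=
  ereal_inf [set dual_norm v | v in A].

(* The weak-star topology is the topology induced on [dual] by pointwise
   convergence, so that compactness of a subset of [dual] may be taken in
   {ptws X -> R^o}. *)
Definition weak_star_compact (A : set (X -> R^o)) : Prop :=
  A `<=` dual /\ compact (A : set {ptws X -> R^o}).

Definition convex_weak_star_compact (A : set (X -> R^o)) : Prop :=
  [/\ A !=set0, convex_set A & weak_star_compact A].

End Dual.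

Section Quasidifferentials.
Context {R : realType} {X : normedModType R}.

Definition is_max (S : set R) (m : R) : Prop := S m /\ ubound S m.

Definition is_min (S : set R) (m : R) : Prop := S m /\ lbound S m.

Definition max_min_representation (D : X -> R) (lo up : set (X -> R^o)) : Prop :=
  forall h : X, exists a b : R,
    [/\ is_max [set v h | v in lo] a,
        is_min [set w h | w in up] b
      & D h = a + b].

(* [fine] is harmless here: [f] is required to be finite in a neighbourhood
   of [x]. *)
Definition dini_quasidifferential (f : X -> \bar R) (x : X)
    (lo up : set (X -> R^o)) : Prop :=
  [/\ \forall z \near x, f z \is a fin_num,
      dini_differentiable (fine \o f) x,
      convex_weak_star_compact lo,
      convex_weak_star_compact up
    & max_min_representation (dini_derivative (fine \o f) x) lo up].

Definition hadamard_quasidifferential (f : X -> \bar R) (x : X)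
    (lo up : set (X -> R^o)) : Prop :=
  [/\ \forall z \near x, f z \is a fin_num,
      hadamard_differentiable (fine \o f) x,
      convex_weak_star_compact lo,
      convex_weak_star_compact up
    & max_min_representation (hadamard_derivative (fine \o f) x) lo up].

End Quasidifferentials.

Definition finite_dimensional (R : realType) (V : lmodType R) : Prop :=
  exists (n : nat) (e : 'I_n -> V),
    forall v : V, exists c : 'I_n -> R, v = \sum_(i < n) c i *: e i.

(* Main.v *)
Require Import Defs.
From HB Require Import structures.
From mathcomp Require Import all_boot all_order all_algebra.
From mathcomp Require Import all_classical all_reals all_analysis.
From mathcomp Require Import ring lra.
Import Order.TTheory GRing.Theory Num.Theory.
Import numFieldNormedType.Exports.
Local Open Scope classical_set_scope.
Local Open Scope ring_scope.

(** For [y] fixed, [psi y x] is the distance from [y] to [F x]; it vanishes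
    exactly when [x] lies in the inverse image of [y].

    Part (1): metric regularity is an error bound for [psi y], and by Ekeland's
    variational principle such a bound with constant [K] holds as soon as, from
    every point where [psi y] is positive, [psi y] can be decreased at a rate
    greater than [K^-1] ([error_bound]). The condition on quasidifferentials
    provides such a decrease: if all elements of the convex weak star compact
    set [lo + w] have norm greater than [K^-1], a vector [h] of the space itself
    separates this set from the ball of radius [K^-1]
    ([strict_descent_direction]), and along [h] the derivative of [psi y], at
    most the maximum of [lo + w] at [h], is below [- K^-1 * `|h|]. The separation
    rests on compactness, which reduces it to finitely many vectors, and on a
    finite dimensional minimax argument ([finite_alternative]).

    Part (2): sufficiency of the slope condition follows from part (1) applied
    with each constant greater than [K]. For necessity, segments in [Y] show that
    metric regularity with a constant less than [t] lets [psi y] decrease at rate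
    [t^-1] towards points arbitrarily near [x] ([regular_descent]). Compactness
    of the unit sphere of [X] and the uniformity built into Hadamard derivatives
    turn this into a unit vector [h] with derivative at most [- t^-1]
    ([hadamard_descent_direction]), and the element of [up] minimal at [h]
    satisfies the slope condition. *)

Set Implicit Arguments.
Unset Strict Implicit.

(** * Ekeland's variational principle *)

(** The conclusion asks for a minimal point below [x0] for the order [below]
    introduced in the proof. Along a chain that at each step nearly minimises
    [f] over the points below the current one, [c] times the distance
    travelled is bounded by the decrease of [f], so the chain is Cauchy; lower
    semicontinuity puts its limit below every member, and near-minimality
    leaves nothing strictly below the limit. *)
Lemma ekeland_variational_principle (R : realType)
    (X : completeNormedModType R) (f : X -> \bar R) (c : R) (x0 : X) :
  lower_semicontinuous f -> (forall x, (0 <= f x)%E) -> 0 < c ->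
  f x0 \is a fin_num ->
  exists2 z, (f z + (c * `|z - x0|)%:E <= f x0)%E &
    forall x, (f x + (c * `|x - z|)%:E <= f z)%E -> x = z.
Proof.
move=> flsc f0 c0 fx0.
pose below x z := (f z + (c * `|z - x|)%:E <= f x)%E.
have below_refl x : below x x by rewrite /below subrr normr0 mulr0 adde0.
have below_le x z : below x z -> (f z <= f x)%E.
  by apply: le_trans; rewrite leeDl// lee_fin mulr_ge0// ltW.
have below_trans x y z : below x y -> below y z -> below x z.
  move=> xy yz; apply: (le_trans _ xy); rewrite /below.
  apply: (le_trans _ (leeD2r _ yz)); rewrite -addeA leeD2l// -EFinD lee_fin.
  rewrite -mulrDr ler_pM2l//; have := ler_distD y z x; lra.
have fin_le x z : f x \is a fin_num -> (f z <= f x)%E -> f z \is a fin_num.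
  by move=> fx zx; rewrite ge0_fin_numE// (le_lt_trans zx)// ltey_eq fx.
have step n x : exists y, f x \is a fin_num -> below x y /\
    forall z, below x z -> (f y <= f z + (n.+1%:R^-1)%:E)%E.
  have [fx|] := boolP (f x \is a fin_num); last by exists x.
  pose S := f @` below x.
  have Sfin : ereal_inf S \is a fin_num.
    rewrite ge0_fin_numE.
      apply: (@le_lt_trans _ _ (f x)); last by rewrite ltey_eq fx.
      by apply: ereal_inf_lbound; exists x.
    by apply: le_ereal_inf_tmp => _ [z _ <-].
  have n0 : 0 < n.+1%:R^-1 :> R by rewrite invr_gt0.
  have [_ [y xy <-] yS] := lb_ereal_inf_adherent n0 Sfin.
  exists y => _; split => // z xz; apply: (le_trans (ltW yS)).
  by rewrite leeD2r// ereal_inf_lbound//; exists z.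
have [s Hs] : {s : nat -> X -> X & forall n x, f x \is a fin_num ->
    below x (s n x) /\
    forall z, below x z -> (f (s n x) <= f z + (n.+1%:R^-1)%:E)%E}.
  have [s Hs] := choice (fun p : nat * X => step p.1 p.2).
  by exists (fun n x => s (n, x)) => n x; exact: (Hs (n, x)).
pose u := fix u n := if n is m.+1 then s m (u m) else x0.
have ufin n : f (u n) \is a fin_num.
  elim: n => //= n IH; apply: (fin_le _ _ IH); apply: below_le.
  by have [] := Hs n _ IH.
have ubelow n m : (n <= m)%N -> below (u n) (u m).
  move=> /subnK <-; elim: (m - n)%N => [//|k IH].
  rewrite addSn /=; apply: (below_trans _ _ _ IH).
  by have [] := Hs (k + n)%N (u (k + n)%N) (ufin _).
pose g n := fine (f (u n)).
have gE n : f (u n) = (g n)%:E by rewrite /g fineK.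
have gdist n m : (n <= m)%N -> c * `|u m - u n| <= g n - g m.
  by move=> /ubelow; rewrite /below !gE -EFinD lee_fin addrC -lerBrDr.
have gni : nonincreasing_seq g.
  by move=> n m nm; rewrite -subr_ge0 (le_trans _ (gdist _ _ nm))// mulr_ge0// ltW.
have glb : has_lbound (range g).
  by exists 0 => _ [n _ <-]; rewrite fine_ge0.
have := nonincreasing_cvgn gni glb; set l := inf _ => gl.
have lg n : l <= g n by apply: ge_inf => //; exists n.
have ucvg : cvg (u @ \oo).
  apply: cauchy_cvg; apply: cauchy_exP => e e0.
  have /cvgrPdist_lt/(_ (c * e))[|N _ /(_ N (leqnn N)) /=] := gl.
    by rewrite mulr_gt0.
  move=> gN; exists (u N); exists N => // m /= Nm.
  rewrite -ball_normE/= distrC -(ltr_pM2l c0).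
  rewrite (le_lt_trans (gdist _ _ Nm))// (le_lt_trans _ gN)//.
  by rewrite distrC (le_trans _ (ler_norm _))// lerB.
pose z := lim (u @ \oo).
(* If [z] were not below [u n], lower semicontinuity would give the same
   strict failure at [u m] for all large [m], against [gdist]. *)
have uz n : below (u n) z.
  rewrite /below leNgt gE; apply/negP => lt.
  have [a a1 a2] : exists2 a, g n - c * `|z - u n| < a & (a%:E < f z)%E.
    move: lt; case fz : (f z) => [fz'||]; last by have := f0 z; rewrite fz.
      rewrite -EFinD lte_fin => lt; pose b := g n - c * `|z - u n|.
      by exists ((b + fz') / 2); rewrite ?lte_fin; rewrite /b; lra.
    by move=> _; exists (g n - c * `|z - u n| + 1); rewrite ?ltry// ltrDl.
  have [V Vz Va] := flsc _ _ a2.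
  have [m [nm Vm dm]] : exists m, [/\ (n <= m)%N, V (u m) &
      c * `|z - u m| < a - (g n - c * `|z - u n|)].
    have Vn : \forall m \near \oo, V (u m) by exact: ucvg.
    have : \forall m \near \oo, `|z - u m| < (a - (g n - c * `|z - u n|)) / c.
      by move/cvgrPdist_lt: ucvg; apply; rewrite divr_gt0// subr_gt0.
    move=> dn; near \oo => m; exists m; split.
    - by near: m; exact: nbhs_infty_ge.
    - by near: m.
    - by rewrite mulrC -ltr_pdivlMr//; near: m.
  have := Va _ Vm; rewrite gE lte_fin.
  have := gdist _ _ nm; have := ler_distD (u m) z (u n).
  rewrite -(ler_pM2l c0) mulrDr; lra.
exists z; first exact: (uz 0%N).
move=> x zx.
have fzx : (f z <= f x)%E.
  have fzf := fin_le _ _ (ufin 0) (below_le _ _ (uz 0)).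
  have fxf := fin_le _ _ fzf (below_le _ _ zx).
  rewrite -(fineK fzf) -(fineK fxf) lee_fin; apply/ler_addgt0Pr => e e0.
  have [n _ /(_ n (leqnn n)) /= ne] := near_infty_natSinv_lt (PosNum e0).
  have [_ /(_ x (below_trans _ _ _ (uz n) zx))] := Hs n _ (ufin n).
  move=> le1; have := le_trans (below_le _ _ (uz n.+1)) le1.
  rewrite -(fineK fzf) -(fineK fxf) -EFinD lee_fin => /le_trans; apply.
  by rewrite lerD2l ltW.
have fxf := fin_le _ _ (fin_le _ _ (ufin 0) (below_le _ _ (uz 0))) (below_le _ _ zx).
have := le_trans zx fzx; rewrite -(fineK fxf) -EFinD lee_fin gerDl.
by rewrite pmulr_rle0// normr_le0 subr_eq0 => /eqP.
Unshelve. all: by end_near. Qed.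

(** The minimal point given by Ekeland's principle with slope [K^-1] stays in
    the ball of radius [r], by the bound on [K * f x]; there a positive value
    of [f] would contradict minimality. *)
Lemma error_bound (R : realType) (X : completeNormedModType R)
    (f : X -> \bar R) (K r : R) (xb x : X) :
  lower_semicontinuous f -> (forall z, (0 <= f z)%E) -> 0 < K ->
  (forall z, `|xb - z| <= r -> f z != 0%E ->
    exists z', (f z' + (K^-1 * `|z' - z|)%:E < f z)%E) ->
  (K%:E * f x < (r - `|x - xb|)%:E)%E ->
  exists2 z, f z = 0%E & (`|x - z|%:E <= K%:E * f x)%E.
Proof.
move=> flsc f0 K0 slope fx.
have Ki : 0 < K^-1 by rewrite invr_gt0.
have fxf : f x \is a fin_num.
  rewrite ge0_fin_numE// ltNge leye_eq; apply/eqP => fxy.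
  by move: fx; rewrite fxy gt0_muley ?lte_fin// ltNge leey.
have [z zx zmin] := ekeland_variational_principle flsc f0 Ki fxf.
have zK : (`|x - z|%:E <= K%:E * f x)%E.
  rewrite -(fineK fxf) -EFinM lee_fin -ler_pdivrMl// distrC -lee_fin fineK//.
  by apply: le_trans zx; rewrite leeDr.
exists z => //; apply/eqP/negPn/negP => fz0.
have zr : `|xb - z| <= r.
  have := le_lt_trans zK fx; rewrite lte_fin.
  have := ler_distD x xb z; rewrite [`|xb - x|]distrC; lra.
have [z' z'z] := slope _ zr fz0.
have z'E := zmin _ (ltW z'z).
by move: z'z; rewrite z'E subrr normr0 mulr0 adde0 ltxx.
Qed.

(** * Separation in the weak star topology *)

Lemma convex_set_comb (R : realType) (X : normedModType R) (A : set (X -> R^o))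
    (t : R) (v w : X -> R^o) :
  convex_set A -> 0 <= t -> t <= 1 -> A v -> A w ->
  A (fun h => t * v h + (1 - t) * w h).
Proof.
move=> cA t0 t1 /mem_set Av /mem_set Aw.
have ti : Itv.spec (@Itv.num_sem R) (Itv.Real `[0%Z, 1%Z]) t.
  by apply/and3P; split; rewrite ?num_real//= in_itv/= t0 t1.
have := cA v w (Itv.mk ti) Av Aw.
by rewrite inE.
Qed.

Lemma eval_continuous (R : realType) (X : topologicalType) (h : X) :
  continuous (fun v : {ptws X -> R^o} => v h : R).
Proof. by move=> v; have := @proj_continuous X (fun=> R^o) h v; apply. Qed.

(** A minimax theorem for finitely many functions. Minimise over [A] the
    squared distance from the vector [F v] to the nonnegative orthant, that is
    the sum of the squared negative parts [N v i]. At a minimiser [v0] the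
    weights [N v0] are the normal of the separating hyperplane, and the first
    order condition along the segments issued from [v0] is the desired
    inequality. Convexity is only asked of the image of [A] under [F], which
    keeps the statement free of any linear structure on [T]. *)
Lemma finite_alternative (R : realType) (T : topologicalType) (I : finType)
    (A : set T) (F : T -> I -> R) :
  A !=set0 -> compact A -> (forall i, continuous (F^~ i)) ->
  (forall v w t, A v -> A w -> 0 <= t -> t <= 1 ->
    exists2 u, A u & forall i, F u i = t * F v i + (1 - t) * F w i) ->
  (forall v, A v -> exists i, F v i < 0) ->
  exists l : I -> R, (forall i, 0 <= l i) /\
    forall v, A v -> \sum_i l i * F v i < 0.
Proof.
move=> A0 kA cF convF neg.
pose N v i : R := Num.max 0 (- F v i).
have cphi : continuous (fun v => \sum_i N v i ^+ 2).
  move=> v; apply: (@cvg_big R I +%R 0 predT (@add_continuous R) _ (nbhs v) _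
    (fun i v => N v i ^+ 2)) => i _.
  apply: (@continuous_comp _ _ _ (N^~ i) (fun x : R => x ^+ 2)); last first.
    exact: exprn_continuous.
  apply: (@continuous_max R T (cst 0) (fun v => - F v i) v).
    exact: cvg_cst.
  by have := cvgN (cF i v); apply.
have [v0 /set_mem Av0 vmin] := @compact_EVT_min T R _ A A0 kA
  (continuous_subspaceT cphi).
exists (N v0); split => [i|v Av]; first by rewrite le_max lexx.
pose D i := F v i - F v0 i.
have NN i : N v0 i * F v0 i = - N v0 i ^+ 2.
  by rewrite /N; case: (lerP 0 (- F v0 i)) => _; ring.
suff D0 : \sum_i N v0 i * D i <= 0.
  rewrite (eq_bigr (fun i => N v0 i * D i - N v0 i ^+ 2)); last first.
    by move=> i _; rewrite -NN /D -mulrDr subrK.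
  rewrite sumrB subr_lt0 (le_lt_trans D0)//.
  have [i Fi] := neg _ Av0.
  rewrite (bigD1 i)//= ltr_wpDr ?sumr_ge0// => [j _|]; first exact: sqr_ge0.
  by rewrite exprn_gt0// lt_max oppr_gt0 Fi orbT.
pose P := \sum_i N v0 i * D i; pose Q := \sum_i D i ^+ 2.
have ineq t : 0 <= t -> t <= 1 -> 2 * t * P <= t ^+ 2 * Q.
  move=> t0 t1.
  have [vt Avt Fvt] := convF _ _ _ Av Av0 t0 t1.
  have := vmin _ (mem_set Avt).
  have FE i : F vt i = F v0 i + t * D i by rewrite Fvt /D; ring.
  (* The squared negative part of a number is at most its squared distance to
     any nonnegative number, here the positive part of [F v0 i]. *)
  have le_i i : N vt i ^+ 2 <= (t * D i - N v0 i) ^+ 2.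
    rewrite /N FE; case: (lerP 0 (- F v0 i)); case: (lerP 0 (- (F v0 i + t * D i)));
      nra.
  move=> /le_trans/(_ (ler_sum _ (fun i _ => le_i i))) le_sums.
  have : 0 <= \sum_i (t * D i - N v0 i) ^+ 2 - \sum_i N v0 i ^+ 2.
    by rewrite subr_ge0.
  rewrite -sumrB (eq_bigr (fun i => t ^+ 2 * D i ^+ 2 -
    2 * t * (N v0 i * D i))); last by move=> i _; ring.
  by rewrite sumrB -!mulr_sumr subr_ge0.
have Q0 : 0 <= Q by apply: sumr_ge0 => i _; exact: sqr_ge0.
rewrite -/P leNgt; apply/negP => P0.
(* [ineq] says [2 * P <= t * Q]; this [t] lies in ]0, 1] and [t * Q <= P]. *)
pose t := P / (P + Q).
have t0 : 0 < t by rewrite divr_gt0// ltr_wpDr.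
have t1 : t <= 1 by rewrite ler_pdivrMr ?mul1r ?lerDl// ltr_wpDr.
have := ineq _ (ltW t0) t1.
rewrite expr2 -mulrA mulrCA -mulrA ler_pM2l// => Pt.
have : t * Q <= P by rewrite /t mulrAC ler_pdivrMr ?ltr_wpDr// ler_pM2l// lerDr ltW.
lra.
Qed.

(** Near-covering, applied to the filter of finite lists ordered by inclusion,
    is the finite subcover property. *)
Lemma compact_finite_open_cover (T : topologicalType) (J : eqType) (A : set T)
    (U : J -> set T) :
  compact A -> (forall j, open (U j)) -> A `<=` \bigcup_j U j ->
  exists s : seq J, forall v, A v -> exists2 j, j \in s & U j v.
Proof.
move=> /compact_near_coveringP kA oU AU.
pose F := filter_from [set: seq J] (fun s : seq J =>
    [set s' : seq J | {subset s <= s'}]).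
have FF : Filter F.
  apply: filter_from_filter; first by exists [::].
  move=> s1 s2 _ _; exists (s1 ++ s2) => //= s sub.
  by split => j js; apply: sub; rewrite mem_cat js ?orbT.
have [|s _ sP] := kA _ F (fun s v => exists2 j, j \in s & U j v) FF.
  move=> v /AU[j _ Ujv].
  exists (U j, [set s : seq J | {subset [:: j] <= s}]).
    split; last by exists [:: j].
    by change (nbhs v (U j)); apply: open_nbhs_nbhs; split.
  by move=> [w s] [/= Ujw js]; exists j => //; apply: js; rewrite mem_head.
by exists s => v; exact: (sP s).
Qed.

Lemma dual_sum (R : realType) (X : normedModType R) (v : X -> R^o)
    (I : finType) (l : I -> R) (h : I -> X) :
  dual v -> v (\sum_i l i *: h i) = \sum_i l i * v (h i).
Proof.
move=> [lv _].
have v0 : v 0 = 0.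
  by have := lv (-1) 0 0; rewrite scaler0 addr0 scaleN1r addNr.
elim/big_rec2: _ => // i y z _ <-; exact: lv.
Qed.

Lemma dual_scale (R : realType) (X : normedModType R) (v : X -> R^o)
    (a : R) (h : X) :
  dual v -> v (a *: h) = a * v h.
Proof.
by move=> /(dual_sum (fun _ : 'I_1 => a) (fun=> h)); rewrite !big_ord1.
Qed.

(** Separation of [A] from the ball of radius [c] in the dual, in the weak
    star topology. Every [v] in [A] violates [0 <= v h + c * `|h|] for some
    [h], since otherwise its norm would be at most [c]. By compactness
    finitely many [h] suffice, and [finite_alternative] weighs them; the
    weighted sum of these [h] is the direction, because [c * `|.|] is
    sublinear. *)
Lemma strict_descent_direction (R : realType) (X : normedModType R)
    (A : set (X -> R^o)) (c : R) :
  0 <= c -> convex_weak_star_compact A -> (c%:E < dual_dist0 A)%E ->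
  exists h, forall v, A v -> v h + c * `|h| < 0.
Proof.
move=> c0 [A0 cA [Adual kA]] dA.
have cst_h h : continuous (fun v : {ptws X -> R^o} => v h + c * `|h| : R).
  by move=> v; have := cvgD (@eval_continuous R X h v) (cvg_cst (c * `|h|)); apply.
have [||s sA] := @compact_finite_open_cover {ptws X -> R^o} X A
    (fun h => [set v | v h + c * `|h| < 0]) kA.
- move=> h; apply: (@open_comp _ _ (fun v : {ptws X -> R^o} => v h + c * `|h|)
    [set x : R | x < 0]); last exact: open_lt.
  by move=> v _; exact: cst_h.
- move=> v Av; apply: contrapT => noh.
  have vh h : 0 <= v h + c * `|h|.
    by rewrite leNgt; apply/negP => lt; apply: noh; exists h.
  suff : (dual_norm v <= c%:E)%E.
    apply/negP; rewrite -ltNge; apply: lt_le_trans dA _.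
    by apply: ereal_inf_lbound; exists v.
  apply: ge_ereal_sup => _ [h /= h1 <-]; rewrite lee_fin.
  have := vh h; have := vh (- h).
  rewrite -scaleN1r (dual_scale _ _ (Adual _ Av)) normrZ normrN1 mul1r.
  have ch : c * `|h| <= c by rewrite ler_piMr.
  by move=> p1 p2; rewrite ler_norml; apply/andP; split; lra.
have [|||l [l0 lneg]] := @finite_alternative R {ptws X -> R^o}
    'I_(size s) A (fun v i => v (tnth (in_tuple s) i) +
      c * `|tnth (in_tuple s) i|) A0 kA.
- by move=> i; exact: cst_h.
- move=> v w t Av Aw t0 t1; exists (fun h => t * v h + (1 - t) * w h).
    exact: convex_set_comb.
  by move=> i; ring.
- move=> v /sA[h hs vh]; have hs' : (index h s < size s)%N by rewrite index_mem.
  by exists (Ordinal hs'); rewrite (tnth_nth h) /= nth_index.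
exists (\sum_i l i *: tnth (in_tuple s) i) => v Av.
apply: (le_lt_trans _ (lneg _ Av)).
rewrite (dual_sum _ _ (Adual _ Av)).
under [leRHS]eq_bigr do rewrite mulrDr.
rewrite big_split lerD2l//= (le_trans (ler_wpM2l c0 (ler_norm_sum _ _ _)))//.
rewrite mulr_sumr; apply: ler_sum => i _.
by rewrite normrZ (ger0_norm (l0 i)) mulrCA.
Qed.

Lemma ptws_translate_continuous (R : realType) (X : normedModType R)
    (w : X -> R^o) :
  continuous (fun v : {ptws X -> R^o} => v + w : {ptws X -> R^o}).
Proof.
move=> v.
apply: (proj2 (@pointwise_cvgP X (R^o : uniformType)
  ((fun v : {ptws X -> R^o} => (v + w : X -> R^o)) @ nbhs v) (v + w) _)) => h.
have vw := cvgD (@eval_continuous R X h v) (cvg_cst (w h)).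
exact: vw.
Qed.

Lemma convex_weak_star_compact_translate (R : realType) (X : normedModType R)
    (A : set (X -> R^o)) (w : X -> R^o) :
  convex_weak_star_compact A -> dual w ->
  convex_weak_star_compact [set v + w | v in A].
Proof.
move=> [[v0 Av0] cA [Adual kA]] [lw cw]; split; first by exists (v0 + w); exists v0.
  move=> _ _ t /set_mem[v1 Av1 <-] /set_mem[v2 Av2 <-]; apply/mem_set.
  have := cA v1 v2 t (mem_set Av1) (mem_set Av2) => /set_mem Av.
  exists (t%:num *: v1 + (unstable.onem t%:num) *: v2) => //.
  apply/funext => h; rewrite /= /conv /= !scalerDr addrACA -scalerDl.
  by rewrite /unstable.onem [_ + (1 - _)]addrC subrK scale1r.
split.
  move=> _ [v /Adual[lv cv] <-]; split.
    by move=> a h1 h2; rewrite !fctE lv lw scalerDr addrACA.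
  by move=> h; exact: (cvgD (cv h) (cw h)).
apply: (@continuous_compact _ _ (fun v : {ptws X -> R^o} =>
  v + w : {ptws X -> R^o}) A) => //.
by apply: continuous_subspaceT; exact: ptws_translate_continuous.
Qed.

(** * Distances to sets *)

Section Distances.
Variables (R : realType) (T : Type) (d : T -> T -> R).

Lemma dist_set_ge0 : (forall a b, 0 <= d a b) ->
  forall a C, (0 <= dist_set d a C)%E.
Proof. by move=> d0 a C; apply: le_ereal_inf_tmp => _ [c _ <-]; rewrite lee_fin. Qed.

Lemma dist_set_le a c (C : set T) : C c -> (dist_set d a C <= (d a c)%:E)%E.
Proof. by move=> Cc; apply: ereal_inf_lbound; exists c. Qed.

Lemma dist_set_lt a (C : set T) e :
  (dist_set d a C < e%:E)%E -> exists2 c, C c & d a c < e.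
Proof. by move=> /ereal_inf_lt[_ [c Cc <-]]; exists c. Qed.

Lemma dist_set_triangle : (forall a b c, d a c <= d a b + d b c) ->
  forall a b (C : set T), (dist_set d a C <= (d a b)%:E + dist_set d b C)%E.
Proof.
move=> tri a b C; rewrite addeC -leeBlDr//; apply: le_ereal_inf_tmp => _ [c Cc <-].
rewrite leeBlDr// (le_trans (dist_set_le a Cc))// -EFinD lee_fin addrC.
exact: tri.
Qed.

End Distances.

Lemma closed_dist_set0 (R : realType) (T : pseudoMetricType R)
    (d : T -> T -> R) (C : set T) (a : T) :
  (forall b c e, d b c < e -> ball b e c) -> closed C ->
  dist_set d a C = 0%E -> C a.
Proof.
move=> dball cC aC; apply: cC => B /nbhs_ballP[e /= e0 eB].
have [|c Cc ac] := @dist_set_lt R T d a C e; first by rewrite aC lte_fin.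
by exists c; split => //; exact/eB/dball.
Qed.

(** * Metric regularity from slopes *)

Lemma ray_cvg (R : realType) (X : normedModType R) (x h : X) :
  x + a *: h @[a --> 0^'+] --> x.
Proof.
apply: cvg_at_right_filter; rewrite -[X in _ --> X]addr0 -[X in _ --> _ + X](scale0r h).
by apply: cvgD; [exact: cvg_cst|apply: cvgZr_tmp; exact: cvg_id].
Qed.

(** The directional derivative along [h] is at most the support function of
    [lo + w] at [h]. The norms in [lo + w] exceed [c], so separation yields a
    direction in which [f] decreases at a rate greater than [c]. *)
Lemma dini_quasidifferential_descent (R : realType) (X : normedModType R)
    (f : X -> \bar R) (x : X) (lo up : set (X -> R^o)) (w : X -> R^o) (c : R) :
  dini_quasidifferential f x lo up -> up w -> 0 <= c ->
  (c%:E < dual_dist0 [set (v + w)%R | v in lo])%E ->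
  exists z, (f z + (c * `|z - x|)%:E < f x)%E.
Proof.
move=> [ffin fdiff klo kup fmm] upw c0 cd.
have dw : dual w by have [_ _ [updual _]] := kup; exact: updual.
have [h hneg] := strict_descent_direction c0
  (convex_weak_star_compact_translate klo dw) cd.
have [_ [b [[[v lov <-] _] [_ bmin] Dh]]] := fmm h.
have Dlt : dini_derivative (fine \o f) x h < - (c * `|h|).
  have bw : b <= w h by apply: bmin; exists w.
  have := hneg (v + w); rewrite fctE => /(_ (ex_intro2 _ _ v lov erefl)).
  rewrite Dh; lra.
have ffinr : \forall a \near 0^'+, f (x + a *: h) \is a fin_num.
  by have := @ray_cvg R X x h => /(_ _ ffin).
near (0 : R)^'+ => a.
have a0 : 0 < a by near: a; exact: nbhs_right_gt.
have fa : f (x + a *: h) \is a fin_num by near: a.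
have : dini_quotient (fine \o f) x h a < - (c * `|h|).
  by near: a; apply: (cvgr_lt _ (fdiff h)).
rewrite /dini_quotient /= ltr_pdivrMr// => qa.
exists (x + a *: h).
rewrite -(fineK fa) -(fineK (nbhs_singleton ffin)) -EFinD lte_fin.
rewrite [x + _]addrC addrK normrZ gtr0_norm// [_ + x]addrC; lra.
Unshelve. all: by end_near. Qed.

Section Regularity.
Variables (R : realType) (X : completeNormedModType R) (Y : Type).
Variables (d : Y -> Y -> R) (F : X -> set Y) (xb : X) (yb : Y).
Hypothesis d_ge0 : forall a b, 0 <= d a b.
Hypothesis d_refl : forall a, d a a = 0.
Hypothesis d_sym : forall a b, d a b = d b a.
Hypothesis Fxyb : F xb yb.

(** When [K * d(y, F x)] is too large for the local estimate, it is already at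
    least [r - r'], where [r' = r / (K + 2)]. The local estimate at [xb]
    bounds the distance from [x] to the inverse image by [r' + K * r'], and
    these two bounds coincide for this choice of [r']. The constant [K] is
    thus kept. *)
Lemma regular_with_shrink (K r : R) : 0 < K -> 0 < r ->
  (forall x y, cball (@normdist R X) xb r x -> cball d yb r y ->
     (K%:E * dist_set d y (F x) < (r - `|x - xb|)%:E)%E ->
     (dist_set (@normdist R X) x (inverse F y) <= K%:E * dist_set d y (F x))%E) ->
  regular_with d F xb yb K (r / (K + 2)).
Proof.
move=> K0 r0 reg x y xr yr.
have K2 : 0 < K + 2 by lra.
set r' := r / (K + 2) in xr yr *.
have rE : r = K * r' + 2 * r' by rewrite -mulrDl mulrC divfK// gt_eqF.
have r'0 : 0 < r' by rewrite divr_gt0.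
have Kr' : 0 < K * r' by rewrite mulr_gt0.
have xr' : `|x - xb| <= r' by move: xr; rewrite /cball /normdist /= distrC.
have r'r : r' <= r by lra.
have [lt|ge] := ltP (K%:E * dist_set d y (F x))%E (r - `|x - xb|)%:E.
  by apply: reg lt; [exact: le_trans r'r|exact: le_trans r'r].
apply: le_trans ge.
apply: (le_trans (dist_set_triangle (fun a b c => ler_distD b a c) _ xb _)).
have psib : (dist_set d y (F xb) <= r'%:E)%E.
  by apply: le_trans (dist_set_le d y Fxyb) _; rewrite lee_fin d_sym.
have Kpsib : (K%:E * dist_set d y (F xb) <= (K * r')%:E)%E.
  by rewrite EFinM lee_pmul2l ?lte_fin.
apply: (@le_trans _ _ ((`|x - xb|)%:E + (K * r')%:E)%E).
  apply: leeD2l; apply: (le_trans _ Kpsib); apply: reg.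
  - by rewrite /cball /normdist /= subrr normr0 ltW.
  - exact: le_trans r'r.
  - apply: (le_lt_trans Kpsib); rewrite subrr normr0 subr0 lte_fin; lra.
rewrite -EFinD lee_fin; lra.
Qed.

Lemma regularity_of_slopes (K r : R) (lo up : Y -> X -> set (X -> R^o)) :
  (forall x y, psi d F y x = 0%E -> F x y) ->
  (forall y, lower_semicontinuous (psi d F y)) ->
  0 < K -> 0 < r ->
  (forall x y, cball (@normdist R X) xb r x -> cball d yb r y -> ~ F x y ->
     dini_quasidifferential (psi d F y) x (lo y x) (up y x) /\
     exists2 w, up y x w &
       (K^-1%:E < dual_dist0 [set (v + w)%R | v in lo y x])%E) ->
  (forall x y, cball (@normdist R X) xb r x -> cball d yb r y ->
     (K%:E * dist_set d y (F x) < (r - `|x - xb|)%:E)%E ->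
     (dist_set (@normdist R X) x (inverse F y)
        <= K%:E * dist_set d y (F x))%E) /\
  metrically_regular d F xb yb /\ (regularity_norm d F xb yb <= K%:E)%E.
Proof.
move=> psi0 psilsc K0 r0 slope.
have local x y : cball (@normdist R X) xb r x -> cball d yb r y ->
     (K%:E * dist_set d y (F x) < (r - `|x - xb|)%:E)%E ->
     (dist_set (@normdist R X) x (inverse F y) <= K%:E * dist_set d y (F x))%E.
  move=> xr yr lt.
  have [||z z0 xz] := error_bound (psilsc y) _ K0 _ lt.
  - by move=> z; exact: dist_set_ge0.
  - move=> z zr z0; have nF : ~ F z y.
      move=> Fzy; move/negP: z0; apply; rewrite eq_le dist_set_ge0// andbT.
      by have := dist_set_le d y Fzy; rewrite d_refl.
    have [qd [w upw cw]] := slope z y zr yr nF.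
    apply: dini_quasidifferential_descent qd upw _ cw.
    by rewrite invr_ge0 ltW.
  - by apply: le_trans xz; apply: dist_set_le; exact: psi0.
have reg := regular_with_shrink K0 r0 local.
have rK : 0 < r / (K + 2) by rewrite divr_gt0//; lra.
split=> //; split; first by exists K, (r / (K + 2)).
by apply: ereal_inf_lbound; exists K => //; split => //; exists (r / (K + 2)).
Qed.

End Regularity.

(** * Hadamard derivatives *)

Lemma hadamard_differentiable_dini (R : realType) (X : normedModType R)
    (f : X -> R) (x h : X) :
  hadamard_differentiable f x ->
  dini_quotient f x h @ 0^'+ --> hadamard_derivative f x h.
Proof.
move=> /(_ h) fh; apply: (cvg_comp (G := filter_prod 0^'+ (nbhs h))
  (fun a : R => (a, h)) (hadamard_quotient f x) _ fh).
move=> A [[P Q] /= [P0 Qh] PQ]; apply: filterS P0 => a Pa.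
by apply: (PQ (a, h)); split => //; exact: nbhs_singleton.
Qed.

Lemma hadamard_quasidifferential_dini (R : realType) (X : normedModType R)
    (f : X -> \bar R) (x : X) (lo up : set (X -> R^o)) :
  hadamard_quasidifferential f x lo up -> dini_quasidifferential f x lo up.
Proof.
move=> [ffin fdiff klo kup fmm].
have lim_eq h := @hadamard_differentiable_dini R X _ x h fdiff.
split=> // [h|h]; first by apply/cvg_ex; eexists; exact: lim_eq.
by rewrite /dini_derivative (cvg_lim _ (lim_eq h)); [exact: fmm|exact: Rhausdorff].
Qed.

(** The limit in the direction [0] is uniform over small [h']. With one fixed
    small step [a], every [z] near [x] reads [x + a *: h'] with [h'] small, so
    [f z - f x] is at most [a] times a constant. *)
Lemma hadamard_differentiable_continuous (R : realType) (X : normedModType R)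
    (f : X -> R) (x : X) :
  hadamard_differentiable f x -> {for x, continuous f}.
Proof.
move=> /(_ 0) f0; apply/cvgrPdist_lt => e e0.
pose l := hadamard_derivative f x 0.
have : \forall p \near filter_prod 0^'+ (nbhs (0 : X)),
    `|l - hadamard_quotient f x p| < 1.
  by move/cvgrPdist_lt : f0; apply.
move=> [[P Q] /= [P0 Q0] PQ].
have l1 : 0 < `|l| + 1 by rewrite ltr_wpDl.
have [a [a0 Pa ae]] : exists a, [/\ 0 < a, P a & a * (`|l| + 1) < e].
  near (0 : R)^'+ => a; exists a; split.
  - by near: a; exact: nbhs_right_gt.
  - by near: a.
  - rewrite -ltr_pdivlMr//; near: a; apply: nbhs_right_lt; exact: divr_gt0.
have Qz : \forall z \near x, Q (a^-1 *: (z - x)).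
  have : a^-1 *: (z - x) @[z --> x] --> (0 : X).
    rewrite -(scaler0 _ a^-1) -(subrr x); apply: cvgZl_tmp.
    by apply: cvgB; [exact: cvg_id|exact: cvg_cst].
  by move/(_ _ Q0).
near=> z.
have Qza : Q (a^-1 *: (z - x)) by near: z.
have := PQ (a, a^-1 *: (z - x)) (conj Pa Qza).
rewrite /hadamard_quotient /= scalerA divff ?gt_eqF// scale1r [x + _]addrC subrK => lq.
have : `|(f z - f x) / a| < `|l| + 1.
  have -> : (f z - f x) / a = l - (l - (f z - f x) / a) by ring.
  by rewrite (le_lt_trans (ler_normB _ _))// ltrD2l.
rewrite normrM normfV (gtr0_norm a0) ltr_pdivrMr// distrC mulrC => fzx.
exact: lt_trans fzx ae.
Unshelve. all: by end_near. Qed.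

(** A Hadamard derivative greater than [- c] at [h] bounds below the
    difference quotients for all small steps and all directions near [h]. If
    this held at every unit vector, compactness of the sphere would make the
    step uniform, which excludes decrease at rate [c] at points arbitrarily
    near [x]. *)
Lemma hadamard_descent_direction (R : realType) (X : normedModType R)
    (f : X -> R) (x : X) (c : R) :
  compact [set h : X | `|h| = 1] -> hadamard_differentiable f x ->
  (forall e, 0 < e -> exists2 x', 0 < `|x' - x| < e &
     f x' + c * `|x' - x| <= f x) ->
  exists2 h, `|h| = 1 & hadamard_derivative f x h <= - c.
Proof.
move=> kS fdiff desc; apply: contrapT => noh.
have Dgt h : `|h| = 1 -> - c < hadamard_derivative f x h.
  by move=> h1; rewrite ltNge; apply/negP => le; apply: noh; exists h.
have /compact_near_coveringP/(_ R 0^'+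
  (fun a h => - c < hadamard_quotient f x (a, h)))[] := kS.
  move=> h /Dgt Dh.
  have [[P Q] /= [P0 Qh] PQ] : \forall p \near filter_prod 0^'+ (nbhs h),
      - c < hadamard_quotient f x p by exact: (cvgr_gt _ (fdiff h)).
  by exists (Q, P) => // -[h' a] [/= Qh' Pa]; apply: (PQ (a, h')).
move=> e /= e0 eP; have [x' /andP[xx' x'e]] := desc _ e0.
apply/negP; rewrite -ltNge.
have := eP `|x' - x| _ xx' (`|x' - x|^-1 *: (x' - x)).
rewrite /ball /= sub0r normrN normr_id => /(_ x'e).
rewrite /= normrZ normfV normr_id mulVf ?gt_eqF// => /(_ erefl).
rewrite /hadamard_quotient /= scalerA divff ?gt_eqF// scale1r [x + _]addrC subrK.
rewrite ltr_pdivlMr//; lra.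
Qed.

Lemma dual_dist0_ge (R : realType) (X : normedModType R) (A : set (X -> R^o))
    (h : X) (c : R) :
  `|h| = 1 -> (forall v, A v -> v h <= - c) -> (c%:E <= dual_dist0 A)%E.
Proof.
move=> h1 Ac; apply: le_ereal_inf_tmp => _ [v /Ac vh <-].
apply: (@le_trans _ _ (`|v h|)%:E); last first.
  by apply: ereal_sup_ubound; exists h => //=; rewrite h1.
by rewrite lee_fin -normrN (le_trans _ (ler_norm _))// lerNr.
Qed.

(** * Compactness of spheres in finite dimension *)

(** A spanning family of minimal length is free: a nontrivial relation would
    express one of its members through the others. *)
Lemma finite_dimensional_basis (R : realType) (X : lmodType R) :
  finite_dimensional X ->
  exists (n : nat) (e : 'I_n -> X),
    (forall x, exists c : 'rV[R]_n, x = \sum_i c ord0 i *: e i) /\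
    forall c : 'rV[R]_n, \sum_i c ord0 i *: e i = 0 -> c = 0.
Proof.
pose P n := exists e : 'I_n -> X,
  forall v : X, exists c : 'I_n -> R, v = \sum_(i < n) c i *: e i.
move=> fdX.
have exP : exists n, `[< P n >] by case: fdX => n nP; exists n; apply/asboolP.
have [n /asboolP[e eX] nmin] := ex_minnP exP.
exists n, e; split => [x|c c0].
  have [c ->] := eX x; exists (\row_i c i).
  by apply: eq_bigr => i _; rewrite mxE.
apply/eqP/negPn/negP => cn0.
have [j cj] : exists j, c ord0 j != 0.
  by apply/rV0Pn.
case: n e eX nmin c c0 cn0 j cj => [|n] e eX nmin c c0 cn0 j cj.
  by case: j cj.
suff /nmin : `[< P n >] by rewrite ltnn.
apply/asboolP; exists (e \o lift j) => v.
have [d ->] := eX v.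
have ej : e j = - \sum_(i < n) (c ord0 (lift j i) / c ord0 j) *: e (lift j i).
  apply: (scalerI cj); rewrite scalerN scaler_sumr; apply/eqP.
  rewrite -addr_eq0; apply/eqP; rewrite -[RHS]c0 (bigD1_ord j)//=.
  by congr +%R; apply: eq_bigr => i _; rewrite scalerA mulrCA divff// mulr1.
exists (fun i => d (lift j i) - d j * (c ord0 (lift j i) / c ord0 j)).
rewrite (bigD1_ord j)//= ej scalerN scaler_sumr -sumrN -big_split /=.
by apply: eq_bigr => i _; rewrite scalerA scalerBl addrC.
Qed.

(** The coordinate map [L] is bounded below on the compact unit sphere of the
    coordinate space, so the coordinates of unit vectors form a closed bounded
    set, and the unit sphere is the image of that set under [L]. *)
Lemma finite_dimensional_sphere_compact (R : realType) (X : normedModType R) :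
  finite_dimensional X -> compact [set x : X | `|x| = 1].
Proof.
move=> /finite_dimensional_basis[n [e [eX efree]]].
pose L (c : 'rV[R]_n) := \sum_i c ord0 i *: e i.
have LZ a c : L (a *: c) = a *: L c.
  by rewrite /L scaler_sumr; apply: eq_bigr => i _; rewrite mxE scalerA.
have cL : continuous L.
  move=> c; apply: (@cvg_big X 'I_n +%R 0 predT (@add_continuous X) _ (nbhs c) _
    (fun i (c : 'rV[R]_n) => c ord0 i *: e i)) => i _.
  by apply: cvgZr_tmp; exact: coord_continuous.
have cnL : continuous (fun c => `|L c|).
  by move=> c; have := cvg_norm (cL c); apply.
pose S := [set c : 'rV[R]_n | `|c| = 1].
have kS : compact S.
  apply: bounded_closed_compact.
    by exists 1; split; [exact: num_real|move=> M M1 c /= ->; exact: ltW].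
  apply: (@preimage_closed _ _ (fun c : 'rV[R]_n => `|c|) [set x | x = 1]).
    by move=> c _; exact: norm_continuous.
  exact: closed_eq.
have [m m0 mL] : exists2 m, 0 < m & forall c, m * `|c| <= `|L c|.
  have normed c : c != 0 -> S (`|c|^-1 *: c).
    by move=> c0; rewrite /S /= normrZ ger0_norm ?invr_ge0// mulVf// normr_eq0.
  have [S0|S0] := pselect (S !=set0); last first.
    exists 1 => // c; have [->|/normed Sc] := eqVneq c 0.
      by rewrite normr0 mulr0.
    by case: S0; exists (`|c|^-1 *: c).
  have [c0 /set_mem Sc0 c0min] := compact_EVT_min S0 kS (continuous_subspaceT cnL).
  exists `|L c0|.
    rewrite normr_gt0; apply/eqP => /efree c00.
    by move: Sc0; rewrite /S /= c00 normr0 => /eqP; rewrite eq_sym oner_eq0.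
  move=> c; have [->|cn0] := eqVneq c 0; first by rewrite normr0 mulr0.
  have nc : 0 < `|c| by rewrite normr_gt0.
  rewrite -ler_pdivlMr// mulrC.
  have -> : `|c|^-1 * `|L c| = `|L (`|c|^-1 *: c)|.
    by rewrite LZ normrZ ger0_norm// invr_ge0.
  exact/c0min/mem_set/normed.
have -> : [set x : X | `|x| = 1] = L @` [set c | `|L c| = 1].
  apply/seteqP; split => [x /= x1|_ [c /= c1 <-]//].
  by have [c xE] := eX x; exists c => /=; rewrite /L -?xE.
apply: continuous_compact; first exact: continuous_subspaceT.
apply: bounded_closed_compact.
  exists m^-1; split; first exact: num_real.
  move=> M mM c /= Lc1; apply: le_trans (ltW mM).
  by rewrite -(ler_pM2l m0) divff ?gt_eqF// -Lc1.
apply: (@preimage_closed _ _ (fun c : 'rV[R]_n => `|L c|) [set x | x = 1]).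
  by move=> c _; exact: cnL.
exact: closed_eq.
Qed.

(** * Slopes from metric regularity *)

Section RegularityToSlopes.
Variables (R : realType) (X Y : normedModType R) (F : X -> set Y).
Variables (xb : X) (yb : Y).

Let psiY := psi (@normdist R Y) F.

Lemma psi_lipschitz y y' x : (psiY y x <= `|y - y'|%:E + psiY y' x)%E.
Proof. exact: (dist_set_triangle (fun a b c => ler_distD b a c)). Qed.

(** Take [u] in [F x] nearly nearest to [y] and move from [u] towards [y] by
    the fraction [s], reaching [ys]. Regularity at [ys] supplies [x'] with
    [ys] in [F x'] and [`|x - x'|] at most about [K * s * p]; as [ys] is
    nearer to [y] than [u], the value [psi y] drops by about [s * p]. Choosing
    [u] with relative error [s ^+ 2] keeps the loss of second order in [s], so
    that for small [s] the rate of decrease is at least [t^-1]. *)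
Lemma regular_descent (K t r e : R) (x : X) (y : Y) (p : R) :
  0 < K -> K < t -> regular_with (@normdist R Y) F xb yb K r ->
  `|xb - x| <= r -> psiY y x = p%:E -> 0 < p -> `|yb - y| + 2 * p <= r ->
  0 < e ->
  exists2 x', 0 < `|x' - x| < e & (psiY y x' + (t^-1 * `|x' - x|)%:E <= psiY y x)%E.
Proof.
move=> K0 Kt reg xr yxp p0 yr e0.
have t0 : 0 < t by lra.
(* The first bound gives [K * (1 + s) < t * (1 - s)], the second keeps [x']
   within [e] of [x]. *)
pose s := Num.min ((t - K) / (2 * (t + K))) (e / (t * p)).
have s0 : 0 < s by rewrite lt_min !divr_gt0 ?mulr_gt0//; lra.
have s1 : s * (2 * (t + K)) <= t - K.
  by rewrite -ler_pdivlMr ?ge_min ?lexx//; lra.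
have s2 : s * (t * p) <= e by rewrite -ler_pdivlMr ?mulr_gt0// ge_min lexx orbT.
have s_lt1 : s < 1 by nra.
have [u Fxu yu] : exists2 u, F x u & `|y - u| < p * (1 + s ^+ 2).
  apply: (@dist_set_lt R Y (@normdist R Y) y (F x)).
  rewrite -/(psi _ F y x) -/(psiY y x) yxp lte_fin.
  by rewrite ltr_pMr// ltrDl exprn_gt0.
pose ys := u + s *: (y - u).
have ysu : `|ys - u| = s * `|y - u|.
  by rewrite /ys [u + _]addrC addrK normrZ gtr0_norm.
have yys : `|y - ys| = (1 - s) * `|y - u|.
  have -> : y - ys = (1 - s) *: (y - u).
    by rewrite /ys opprD addrA scalerBl scale1r.
  by rewrite normrZ gtr0_norm ?subr_gt0.
have ysr : `|yb - ys| <= r.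
  apply: le_trans yr; apply: (le_trans (ler_distD y _ _)); rewrite lerD2l yys.
  have ssq1 : s ^+ 2 <= 1 by rewrite exprn_ile1 ?ltW.
  have q0 : 0 <= s * `|y - u| by rewrite mulr_ge0// ltW.
  have : p * s ^+ 2 <= p by rewrite ler_piMr// ltW.
  lra.
have psis : (psiY ys x <= (s * `|y - u|)%:E)%E.
  by rewrite -ysu; exact: (dist_set_le (@normdist R Y)).
have [x' Fx' xx'] : exists2 x', F x' ys & `|x - x'| < t * (1 - s) * (s * p).
  apply: (@dist_set_lt R X (@normdist R X) x (inverse F ys)).
  apply: (le_lt_trans (reg x ys xr ysr)).
  apply: (@le_lt_trans _ _ (K%:E * (s * `|y - u|)%:E)%E).
    by rewrite lee_pmul2l ?lte_fin.
  rewrite -EFinM lte_fin mulrCA [X in _ < X](_ : _ = s * (t * (1 - s) * p)); last by ring.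
  rewrite ltr_pM2l//; apply: (@lt_le_trans _ _ (K * (p * (1 + s ^+ 2)))).
    by rewrite ltr_pM2l.
  rewrite mulrCA [X in _ <= X]mulrC ler_pM2l//; nra.
have psix' : (psiY y x' <= ((1 - s) * `|y - u|)%:E)%E.
  by rewrite -yys; exact: (dist_set_le (@normdist R Y)).
have yu2 : (1 - s) * `|y - u| <= (1 - s) * (p * (1 + s ^+ 2)).
  by rewrite ler_pM2l ?subr_gt0// ltW.
have drop : (1 - s) * (p * (1 + s ^+ 2)) <= p - (1 - s) * (s * p).
  rewrite -subr_ge0; have -> : p - (1 - s) * (s * p) -
    (1 - s) * (p * (1 + s ^+ 2)) = p * s ^+ 3 by ring.
  by rewrite mulr_ge0 ?exprn_ge0 ?ltW.
have sp0 : 0 < s * p by rewrite mulr_gt0.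
exists x'.
  rewrite distrC; apply/andP; split.
    rewrite normr_gt0 subr_eq0; apply/eqP => xE.
    move: psix'; rewrite -xE yxp lee_fin; nra.
  apply: (lt_le_trans xx'); apply: le_trans s2.
  have : 0 < t * (s * p) by rewrite mulr_gt0.
  nra.
apply: (@le_trans _ _ (((1 - s) * `|y - u|)%:E + (t^-1 * `|x' - x|)%:E)%E).
  exact: leeD2r.
rewrite yxp -EFinD lee_fin.
have : t^-1 * `|x' - x| <= (1 - s) * (s * p).
  by rewrite ler_pdivrMl// mulrA distrC ltW.
lra.
Qed.

End RegularityToSlopes.

(** Near [(xb, yb)] the value [psi y x] is small, because [psi yb] is
    continuous at [xb] and [psi] is 1-Lipschitz in [y]; hence
    [regular_descent] applies and some unit vector [h] has derivative at most
    [- t^-1]. The element [w] of [up y x] attaining the minimum at [h] is the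
    one sought: all [v + w] are at most [- t^-1] at [h], so their norms are at
    least [t^-1]. *)
Lemma slopes_of_regularity (R : realType) (X Y : normedModType R)
    (F : X -> set Y) (xb : X) (yb : Y) (K r : R)
    (lo up : Y -> X -> set (X -> R^o)) :
  (forall x, closed (F x)) -> F xb yb -> finite_dimensional X -> 0 < r ->
  (forall x y, cball (@normdist R X) xb r x ->
     hadamard_quasidifferential (psi (@normdist R Y) F y) x (lo y x) (up y x)) ->
  (regularity_norm (@normdist R Y) F xb yb <= K%:E)%E ->
  forall t : R, K < t ->
    exists U : set (X * Y),
      [/\ nbhs (xb, yb) U,
          U `<=` cball (@normdist R X) xb r `*` [set: Y]
        & forall x y, (U `\` graph F) (x, y) ->
            exists2 w, up y x w &
              (t^-1%:E <= dual_dist0 [set (v + w)%R | v in lo y x])%E].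
Proof.
move=> Fcl Fxyb fdX r0 qd normK t Kt.
have [_ [K' [K'0 [r' r'0 reg]] <-]] := ereal_inf_lt
  (le_lt_trans normK (Kt : (K%:E < t%:E)%E)).
rewrite lte_fin => K't.
have t0 : 0 < t := lt_trans K'0 K't.
have d0 (a b : Y) : 0 <= normdist a b by rewrite normr_ge0.
have xbr : cball (@normdist R X) xb r xb.
  by rewrite /cball /normdist /= subrr normr0 ltW.
have psib : psi (@normdist R Y) F yb xb = 0%E.
  apply/eqP; rewrite eq_le dist_set_ge0// andbT.
  by have := dist_set_le (@normdist R Y) yb Fxyb;
    rewrite /normdist subrr normr0.
have psib_small : \forall x \near xb,
    (psi (@normdist R Y) F yb x < (r' / 8)%:E)%E.
  have [ffin fdiff _ _ _] := qd xb yb xbr.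
  have fc := hadamard_differentiable_continuous fdiff.
  near=> x.
  have fx : psi (@normdist R Y) F yb x \is a fin_num by near: x.
  rewrite -(fineK fx) lte_fin; near: x; apply: (cvgr_lt _ fc).
  by rewrite /= psib divr_gt0.
exists [set z : X * Y | [/\ `|xb - z.1| <= Num.min r r', `|yb - z.2| <= r' / 8 &
  (psi (@normdist R Y) F yb z.1 < (r' / 8)%:E)%E]]; split.
- exists ([set x | `|xb - x| <= Num.min r r'] `&`
    [set x | (psi (@normdist R Y) F yb x < (r' / 8)%:E)%E],
    [set y | `|yb - y| <= r' / 8]); last by move=> [x y] [/= [? ?] ?]; split.
  split => /=.
    apply: filterI => //; have rr' : 0 < Num.min r r' by rewrite lt_min r0 r'0.
    by near=> x; apply: ltW; near: x; apply: cvgr_dist_lt rr'; exact: cvg_id.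
  have r8 : 0 < r' / 8 by rewrite divr_gt0.
  by near=> y; apply: ltW; near: y; apply: cvgr_dist_lt r8; exact: cvg_id.
- by move=> [x y] [/=]; rewrite le_min => /andP[].
move=> x y [[/=]]; rewrite le_min => /andP[xr xr'] yr psibx nF.
have [ffin fdiff _ _ fmm] := qd x y xr.
have fx := nbhs_singleton ffin.
set p := fine (psi (@normdist R Y) F y x).
have pE : psi (@normdist R Y) F y x = p%:E by rewrite fineK.
have p0 : 0 < p.
  rewrite lt_neqAle fine_ge0 ?dist_set_ge0// andbT; apply/eqP => p_0.
  apply: nF; apply: (@closed_dist_set0 R Y (@normdist R Y) _ _ _ (Fcl x)).
    by move=> a b e; rewrite -ball_normE.
  by move: pE; rewrite -p_0.
have p4 : p < r' / 8 + r' / 8.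
  rewrite -lte_fin -pE EFinD.
  apply: le_lt_trans (psi_lipschitz F _ yb _) _.
  by rewrite lee_ltD// lee_fin distrC.
have yp : `|yb - y| + 2 * p <= r' by lra.
have desc e : 0 < e -> exists2 x', 0 < `|x' - x| < e &
    fine (psi (@normdist R Y) F y x') + t^-1 * `|x' - x|
      <= fine (psi (@normdist R Y) F y x).
  move=> e0.
  have [x' x'e le] := regular_descent K'0 K't reg xr' pE p0 yp e0.
  exists x' => //; rewrite -lee_fin EFinD (fineK fx) fineK//.
  rewrite ge0_fin_numE ?dist_set_ge0// (le_lt_trans _ (le_lt_trans le _))//.
    by rewrite leeDl// lee_fin mulr_ge0// invr_ge0 ltW.
  by rewrite pE ltry.
have [h h1 Dh] := hadamard_descent_direction
  (finite_dimensional_sphere_compact fdX) fdiff desc.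
have [_ [_ [[[v0 lov0 <-] maxa] [[w upw <-] _] DE]]] := fmm h.
exists w => //; apply: (dual_dist0_ge h1) => _ [v lov <-].
apply: le_trans Dh; rewrite DE fctE lerD2r; apply: maxa.
by exists v.
Unshelve. all: by end_near. Qed.

(** * Metric regularity from nonstrict slopes *)

(** For [s > K], the hypothesis at a [t] strictly between [K] and [s] gives
    slopes strictly greater than [s^-1], as the strict criterion requires. *)
Lemma regularity_of_weak_slopes (R : realType) (X : completeNormedModType R)
    (Y : normedModType R) (F : X -> set Y) (xb : X) (yb : Y) (K : R)
    (lo up : Y -> X -> set (X -> R^o)) (r : R) :
  (forall x, closed (F x)) ->
  (forall y, lower_semicontinuous (psi (@normdist R Y) F y)) ->
  F xb yb -> 0 < K ->
  (forall x y, cball (@normdist R X) xb r x ->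
     hadamard_quasidifferential (psi (@normdist R Y) F y) x (lo y x) (up y x)) ->
  (forall t : R, K < t ->
    exists U : set (X * Y),
      [/\ nbhs (xb, yb) U,
          U `<=` cball (@normdist R X) xb r `*` [set: Y]
        & forall x y, (U `\` graph F) (x, y) ->
            exists2 w, up y x w &
              (t^-1%:E <= dual_dist0 [set (v + w)%R | v in lo y x])%E]) ->
  metrically_regular (@normdist R Y) F xb yb /\
  (regularity_norm (@normdist R Y) F xb yb <= K%:E)%E.
Proof.
move=> Fcl psilsc Fxyb K0 qd slopes.
have reg s : K < s -> metrically_regular (@normdist R Y) F xb yb /\
    (regularity_norm (@normdist R Y) F xb yb <= s%:E)%E.
  move=> Ks; pose t := (K + s) / 2.
  have [Kt ts] : K < t /\ t < s by rewrite /t; split; lra.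
  have [U [[[A B] /= [/nbhs_ballP[a /= a0 aA] /nbhs_ballP[b /= b0 bB]] AB] Ur Uslope]] :=
    slopes t Kt.
  pose rho := Num.min a b / 2.
  have m0 : 0 < Num.min a b by rewrite lt_min a0 b0.
  have rho0 : 0 < rho by rewrite divr_gt0.
  have rhoab : (rho < a) && (rho < b) by rewrite -lt_min /rho; lra.
  move/andP : rhoab => [rhoa rhob].
  have [||||||||_ //] := @regularity_of_slopes R X Y (@normdist R Y) F xb yb
    _ _ _ Fxyb s rho lo up.
  - by move=> c d; exact: normr_ge0.
  - by move=> c; rewrite /normdist subrr normr0.
  - by move=> c d; rewrite /normdist distrC.
  - move=> x y; apply: closed_dist_set0 => //.
    by move=> c d e; rewrite -ball_normE.
  - exact: psilsc.
  - lra.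
  - exact: rho0.
  move=> x y xr yr nF.
  have Uxy : U (x, y).
    apply: AB; split; [apply: aA|apply: bB]; rewrite -ball_normE /=.
      exact: le_lt_trans rhoa.
    exact: le_lt_trans rhob.
  split; first by apply/hadamard_quasidifferential_dini/qd; case: (Ur _ Uxy).
  have [w upw tw] := Uslope x y (conj Uxy nF).
  exists w => //; apply: lt_le_trans tw.
  by rewrite lte_fin ltf_pV2 ?posrE//; lra.
split; first by have [] := reg (K + 1) _; rewrite ?ltrDl.
apply/lee_addgt0Pr => e e0.
by have [] := reg (K + e) _; rewrite ?ltrDl// EFinD.
Qed.

Unset Implicit Arguments.
Set Strict Implicit.

Theorem theorem1 (R : realType) (X : completeNormedModType R) :
  (forall (Y : completeMetricType R) (F : X -> set Y) (xb : X) (yb : Y) (K : R)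
     (lo up : Y -> X -> set (X -> R^o)) (r : R),
     (forall x, closed (F x)) ->
     (forall y, lower_semicontinuous (psi mdist F y)) ->
     graph F (xb, yb) ->
     0 < K ->
     0 < r ->
     (forall x y, cball (@normdist R X) xb r x -> cball mdist yb r y ->
        ~ F x y ->
        dini_quasidifferential (psi mdist F y) x (lo y x) (up y x) /\
        exists2 w, up y x w &
          (K^-1%:E < dual_dist0 [set (v + w)%R | v in lo y x])%E) ->
     (forall x y, cball (@normdist R X) xb r x -> cball mdist yb r y ->
        (K%:E * dist_set mdist y (F x) < (r - `|x - xb|)%:E)%E ->
        (dist_set (@normdist R X) x (inverse F y)
           <= K%:E * dist_set mdist y (F x))%E) /\
     metrically_regular mdist F xb yb /\
     (regularity_norm mdist F xb yb <= K%:E)%E)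
  /\
  (forall (Y : completeNormedModType R) (F : X -> set Y) (xb : X) (yb : Y)
     (K : R) (lo up : Y -> X -> set (X -> R^o)) (r : R),
     (forall x, closed (F x)) ->
     (forall y, lower_semicontinuous (psi (@normdist R Y) F y)) ->
     graph F (xb, yb) ->
     0 < K ->
     finite_dimensional X ->
     0 < r ->
     (forall x y, cball (@normdist R X) xb r x ->
        hadamard_quasidifferential (psi (@normdist R Y) F y) x
          (lo y x) (up y x)) ->
     (metrically_regular (@normdist R Y) F xb yb /\
      (regularity_norm (@normdist R Y) F xb yb <= K%:E)%E)
     <->
     (forall t : R, K < t ->
        exists U : set (X * Y),
          [/\ nbhs (xb, yb) U,
              U `<=` cball (@normdist R X) xb r `*` [set: Y]
            & forall x y, (U `\` graph F) (x, y) ->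
                exists2 w, up y x w &
                  (t^-1%:E <= dual_dist0 [set (v + w)%R | v in lo y x])%E])).
Proof.
split.
  move=> Y F xb yb K lo up r Fcl psilsc Fxyb K0 r0 slopes.
  apply: regularity_of_slopes slopes => //.
  - exact: mdist_ge0.
  - exact: mdistxx.
  - exact: metric_sym.
  - by move=> x y; apply: closed_dist_set0 => // b c e; rewrite ballEmdist.
move=> Y F xb yb K lo up r Fcl psilsc Fxyb K0 fdX r0 qd; split.
  by move=> [_ normK]; exact: slopes_of_regularity Fxyb fdX r0 qd normK.
exact: regularity_of_weak_slopes.
Qed.
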